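(* Let $R$ be a domain and $R[X]$ the polynomial ring in one indeterminate over $R$. Then $R$ is $t$-potent if and only if $R[X]$ is $t$-potent; and $R$ is $t$-super potent if and only if $R[X]$ is $t$-super potent.
   Context: For a domain $R$ with quotient field $K$ and a nonzero fractional ideal $I$ of $R$, put $I^{-1}=\{x\in K: xI\subseteq R\}$, $I^v=(I^{-1})^{-1}$, and $I^t=\bigcup J^v$, the union over all nonzero finitely generated subideals $J$ of $I$. A $t$-ideal is a nonzero ideal $I$ with $I^t=I$. A maximal $t$-ideal is an ideal of $R$ maximal among the proper $t$-ideals. A nonzero ideal $I$ is $t$-invertible if $(II^{-1})^t=R$. A nonzero finitely generated ideal $I$ of $R$ is $t$-rigid if it is contained in exactly one maximal $t$-ideal, and $t$-super rigid if, in addition, every finitely generated ideal $J\supseteq I$ of $R$ is $t$-invertible. The domain $R$ is $t$-potent (respectively $t$-super potent) if each maximal $t$-ideal of $R$ contains a $t$-rigid (respectively $t$-super rigid) ideal. *)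

(* Defs.v *)
From mathcomp Require Import all_boot all_order all_algebra.
From mathcomp Require Import boolp classical_sets.

Set Implicit Arguments.
Unset Strict Implicit.
Unset Printing Implicit Defensive.

Import GRing.Theory.

Local Open Scope classical_set_scope.
Local Open Scope ring_scope.

(* Ideals of R and fractional ideals alike are subsets of the quotient field
   {fraction R}; R itself is identified with its image under tofrac, so an
   ideal of R is an R-submodule of {fraction R} contained in that image. *)

Definition base_ring (R : idomainType) : set {fraction R} :=
  range (@tofrac R).

Arguments base_ring R _ : clear implicits.

Definition submodule (R : idomainType) (I : set {fraction R}) : Prop :=
  I 0 /\ forall (a : R) (x y : {fraction R}), I x -> I y -> I (tofrac a * x + y).

Definition ideal (R : idomainType) (I : set {fraction R}) : Prop :=
  submodule I /\ I `<=` base_ring R.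

Definition nonzero (R : idomainType) (I : set {fraction R}) : Prop :=
  exists2 x, I x & x != 0.

(* A finitely generated R-submodule of {fraction R} is automatically a
   fractional ideal: clear the denominators of the generators. *)
Definition finitely_generated (R : idomainType) (I : set {fraction R}) : Prop :=
  exists (n : nat) (g : 'I_n -> {fraction R}),
    I = [set x | exists c : 'I_n -> R, x = \sum_(i < n) tofrac (c i) * g i].

Definition inverse (R : idomainType) (I : set {fraction R}) :
    set {fraction R} :=
  [set x | forall y, I y -> base_ring R (x * y)].

Definition product (R : idomainType) (I J : set {fraction R}) :
    set {fraction R} :=
  [set x | exists (n : nat) (a b : 'I_n -> {fraction R}),
    [/\ forall i, I (a i), forall i, J (b i) & x = \sum_(i < n) a i * b i]].

Definition v_closure (R : idomainType) (I : set {fraction R}) :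
    set {fraction R} :=
  inverse (inverse I).

Definition t_closure (R : idomainType) (I : set {fraction R}) :
    set {fraction R} :=
  \bigcup_(J in [set J | [/\ finitely_generated J, nonzero J & J `<=` I]])
    v_closure J.

Definition t_ideal (R : idomainType) (I : set {fraction R}) : Prop :=
  [/\ ideal I, nonzero I & t_closure I = I].

Definition maximal_t_ideal (R : idomainType) (M : set {fraction R}) : Prop :=
  [/\ t_ideal M, M <> base_ring R &
      forall I, t_ideal I -> I <> base_ring R -> M `<=` I -> I = M].

Definition t_invertible (R : idomainType) (I : set {fraction R}) : Prop :=
  [/\ ideal I, nonzero I & t_closure (product I (inverse I)) = base_ring R].

Definition t_rigid (R : idomainType) (I : set {fraction R}) : Prop :=
  [/\ ideal I, nonzero I, finitely_generated I &
      exists! M, maximal_t_ideal M /\ I `<=` M].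

Definition t_super_rigid (R : idomainType) (I : set {fraction R}) : Prop :=
  t_rigid I /\
  forall J, ideal J -> finitely_generated J -> I `<=` J -> t_invertible J.

Definition t_potent (R : idomainType) : Prop :=
  forall M : set {fraction R}, maximal_t_ideal M ->
    exists2 I, t_rigid I & I `<=` M.

Definition t_super_potent (R : idomainType) : Prop :=
  forall M : set {fraction R}, maximal_t_ideal M ->
    exists2 I, t_super_rigid I & I `<=` M.

(* Main.v *)
Require Import Defs.
From mathcomp Require Import all_boot all_order all_algebra.
From mathcomp Require Import boolp classical_sets.

(** Write I[X] for the set of polynomials with coefficients in I ([polys I])
and c(J) for the set of coefficients of the polynomials in J ([content J]);
for ideals, J is contained in I[X] if and only if c(J) is contained in I.

The theorem rests on the shape of the maximal t-ideals N of R[X].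

- If N meets R outside 0, then N = M[X] for a maximal t-ideal M of R, and all
  the ideals M[X] occur ([maximal_t_ideal_constant], [maximal_t_ideal_polys]).
  Indeed, if c(N)^t is proper, then N lies in the proper t-ideal c(N)^t[X] and
  equals it. Otherwise c(N)^t = R, so that N contains a superprimitive
  polynomial g, one with c(g)^-1 = R. Given a nonzero constant a in N, an
  argument of McCoy ([mccoy], applied modulo a principal ideal of R) yields
  (a, g)^-1 = R[X], and then 1 is in N.
- If N meets R in 0, then N again contains a superprimitive g. If f is a
  nonzero polynomial of least degree in N, the same argument shows that
  (f, g)^v = N. As f divides a g for some nonzero a in R, the fraction a / f
  is in (f, g)^-1 and f (a / f) = a is not in N. Such an N always contains a
  t-super rigid ideal, namely (f, g) ([upper_t_super_rigid]), whatever R is.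

What remains is to carry ideals along M and M[X]. By the inclusion criterion
above, I t-rigid gives I[X] t-rigid, and J t-rigid inside some M[X] gives c(J)
t-rigid. For super rigidity, an ideal is t-invertible as soon as no maximal
t-ideal contains its product with its inverse ([t_invertibleP]).
If J contains I[X] and c(J) is t-invertible, then u c is not in M for some
u in c(J)^-1 and some c in c(J); this u is also in J^-1, and c is a coefficient
of some p in J, so that u p is not in M[X] ([t_super_rigid_polys]). Conversely
an ideal I containing c(J) is t-invertible because I[X] is
([t_invertible_of_polys]). *)

Set Implicit Arguments.
Unset Strict Implicit.
Unset Printing Implicit Defensive.

Import GRing.Theory.

Local Open Scope classical_set_scope.
Local Open Scope ring_scope.

Local Notation "x %:F" := (@tofrac _ x).

(** * Submodules of the quotient field *)

Section Submodules.

Variable R : idomainType.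
Local Notation K := {fraction R}.
Implicit Types (x y : K) (X Y I J : set K) (s t : seq K).

Lemma fraction_repr x : exists a b : R, b != 0 /\ x = a%:F / b%:F.
Proof.
elim/quotW: x => -[[a b] /= b0]; exists a, b; split=> //.
apply: (canRL (mulfK _)); first by rewrite tofrac_eq0.
unlock tofrac; rewrite [_ * _]piE; apply/eqmodP.
rewrite /= FracField.equivfE /FracField.mulf /=.
by rewrite !numden_Ratio ?oner_eq0 ?mulr1// mulrC.
Qed.

Lemma base_ringE (a : R) : base_ring R a%:F.
Proof. by exists a. Qed.

Lemma base_ringM x y : base_ring R x -> base_ring R y -> base_ring R (x * y).
Proof. by move=> [a _ <-] [b _ <-]; rewrite -tofracM; exact: base_ringE. Qed.

Lemma base_ring1 : base_ring R 1.
Proof. by rewrite -(tofrac1 R); exact: base_ringE. Qed.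

Lemma submodule_base_ring : submodule (base_ring R).
Proof.
split=> [|a x y [b _ <-] [c _ <-]]; first by exists 0; rewrite ?tofrac0.
by rewrite -tofracM -tofracD; exact: base_ringE.
Qed.

Lemma submoduleD I x y : submodule I -> I x -> I y -> I (x + y).
Proof. by move=> [_ H] Ix Iy; have := H 1 x y Ix Iy; rewrite tofrac1 mul1r. Qed.

Lemma submoduleZ I (a : R) x : submodule I -> I x -> I (a%:F * x).
Proof. by move=> [I0 H] Ix; have := H a x 0 Ix I0; rewrite addr0. Qed.

Lemma submoduleB I x y : submodule I -> I x -> I y -> I (x - y).
Proof.
move=> sI Ix Iy; apply: (submoduleD sI Ix).
by have := submoduleZ (-1) sI Iy; rewrite tofracN tofrac1 mulN1r.
Qed.

Lemma submodule_sum I (T : Type) (r : seq T) (P : pred T) (F : T -> K) :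
  submodule I -> (forall i, P i -> I (F i)) -> I (\sum_(i <- r | P i) F i).
Proof.
move=> sI HF; apply: (big_ind I) => //; first by case: sI.
by move=> x y; exact: submoduleD.
Qed.

Lemma ideal_base_ring I : ideal I -> I 1 -> I = base_ring R.
Proof.
move=> [sI IR] I1; apply/seteqP; split=> // x [a _ <-].
by rewrite -[a%:F]mulr1; exact: submoduleZ.
Qed.

Lemma submodule_inverse X : submodule (inverse X).
Proof.
split=> [y _|a x y Hx Hy z Xz]; first by rewrite mul0r; case: submodule_base_ring.
by rewrite mulrDl -mulrA; apply: (submodule_base_ring.2); [exact: Hx|exact: Hy].
Qed.

Lemma inverse_anti X Y : X `<=` Y -> inverse Y `<=` inverse X.
Proof. by move=> XY x Hx y /XY; exact: Hx. Qed.

Lemma v_closure_mono X Y : X `<=` Y -> v_closure X `<=` v_closure Y.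
Proof. by move=> XY; do 2!apply: inverse_anti. Qed.

Lemma sub_v_closure X : X `<=` v_closure X.
Proof. by move=> x Xx u Hu; rewrite mulrC; exact: Hu. Qed.

Lemma inverse_v_closure X : inverse (v_closure X) = inverse X.
Proof.
apply/seteqP; split; first exact: inverse_anti (@sub_v_closure X).
by move=> u Hu y; rewrite mulrC; exact.
Qed.

(** Holds because taking the inverse three times is the same as taking it
once. *)
Lemma v_closure_min X Y : X `<=` v_closure Y -> v_closure X `<=` v_closure Y.
Proof.
by move=> /v_closure_mono; rewrite {2}/v_closure inverse_v_closure.
Qed.

(** The span is defined by its universal property, which turns inclusions of
finitely generated submodules into statements on generators. *)
Definition spanned s : set K :=
  [set x | forall I, submodule I -> [set` s] `<=` I -> I x].

Lemma submodule_spanned s : submodule (spanned s).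
Proof.
split=> [I [] //|a x y Hx Hy I sI sub].
by apply: sI.2; [exact: Hx|exact: Hy].
Qed.

Lemma sub_spanned s : [set` s] `<=` spanned s.
Proof. by move=> x xs I _; exact. Qed.

Lemma spanned_min s I : submodule I -> [set` s] `<=` I -> spanned s `<=` I.
Proof. by move=> sI sub x; exact. Qed.

Lemma combinations_spanned n (g : 'I_n -> K) :
  [set x | exists c : 'I_n -> R, x = \sum_(i < n) (c i)%:F * g i] =
  spanned [seq g i | i <- enum 'I_n].
Proof.
apply/seteqP; split=> [x [c ->]|].
  apply: submodule_sum (submodule_spanned _) _ => i _.
  apply: submoduleZ (submodule_spanned _) _; apply: sub_spanned.
  by apply: map_f; rewrite mem_enum.
apply: spanned_min => [|_ /mapP[i _ ->]].
  split; first by exists (fun=> 0); rewrite big1// => i _; rewrite tofrac0 mul0r.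
  move=> a _ _ [c ->] [d ->]; exists (fun i => a * c i + d i).
  rewrite mulr_sumr -big_split; apply: eq_bigr => i _.
  by rewrite tofracD tofracM mulrDl mulrA.
exists (fun j => (j == i)%:R); rewrite (bigD1 i)//= eqxx tofrac1 mul1r.
by rewrite big1 ?addr0// => j /negPf ->; rewrite tofrac0 mul0r.
Qed.

Lemma finitely_generatedP I : finitely_generated I <-> exists s, I = spanned s.
Proof.
split=> [[n [g ->]]|[s ->]]; first by eexists; exact: combinations_spanned.
exists (size s), (fun i => s`_i); rewrite combinations_spanned; congr spanned.
by rewrite -[LHS](mkseq_nth 0) /mkseq -val_enum_ord -map_comp.
Qed.

Lemma inverse_spanned s : inverse (spanned s) = inverse [set` s].
Proof.
apply/seteqP; split; first exact: inverse_anti (@sub_spanned s).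
move=> u Hu x; rewrite mulrC.
suff : spanned s `<=` v_closure [set` s] by move/(_ x)=> H /H; exact.
by apply: spanned_min; [exact: submodule_inverse|exact: sub_v_closure].
Qed.

Lemma submodule_product X J : submodule J -> submodule (product X J).
Proof.
move=> sJ; split.
  exists 0%N, (fun=> 0), (fun=> 0); split; [by case|by case|].
  by rewrite big_ord0.
move=> a _ _ [m [u [v [Xu Jv ->]]]] [n [u' [v' [Xu' Jv' ->]]]].
exists (m + n)%N, (fun i => match split i with inl j => u j | inr j => u' j end),
  (fun i => match split i with inl j => a%:F * v j | inr j => v' j end).
split.
- by move=> i; case: split.
- by move=> i; case: split => // j; exact: submoduleZ.
- rewrite big_split_ord mulr_sumr; congr (_ + _); apply: eq_bigr => i _.
    by rewrite -[lshift n i]/(unsplit (inl i)) unsplitK mulrCA.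
  by rewrite -[rshift m i]/(unsplit (inr i)) unsplitK.
Qed.

Lemma mem_product X Y x y : X x -> Y y -> product X Y (x * y).
Proof.
move=> Xx Yy; exists 1%N, (fun=> x), (fun=> y); split=> //.
by rewrite big_ord1.
Qed.

Lemma product_min X Y I : submodule I ->
  (forall x y, X x -> Y y -> I (x * y)) -> product X Y `<=` I.
Proof.
move=> sI H _ [n [u [v [Xu Yv ->]]]].
by apply: submodule_sum => // i _; exact: H.
Qed.

End Submodules.

(** * The t-closure and maximal t-ideals *)

Section TIdeals.

Variable R : idomainType.
Local Notation K := {fraction R}.
Implicit Types (x y : K) (X Y I J M : set K) (s t : seq K).

(** Only the generators of a finitely generated J enter J^v. A nonzero
element of I can be added to them, which disposes of the requirement that J be
nonzero. *)
Lemma t_closureP I x : submodule I -> nonzero I ->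
  t_closure I x <-> exists2 s : seq K, [set` s] `<=` I & v_closure [set` s] x.
Proof.
move=> sI [z Iz z0]; split=> [[J [/finitely_generatedP[s ->] _ sJ]] Jx|[s sJ sx]].
  exists s; first by move=> y ys; apply: sJ; exact: sub_spanned.
  by rewrite /v_closure -inverse_spanned.
have zsI : [set` z :: s] `<=` I.
  by move=> y /=; rewrite inE => /predU1P[->|/sJ].
exists (spanned (z :: s)).
  split; first by apply/finitely_generatedP; exists (z :: s).
    by exists z => //; apply: sub_spanned; rewrite /= mem_head.
  exact: spanned_min.
rewrite /v_closure inverse_spanned; apply: v_closure_mono sx.
by move=> y ys; rewrite /= inE ys orbT.
Qed.

Lemma sub_t_closure I : submodule I -> nonzero I -> I `<=` t_closure I.
Proof.
move=> sI nI x Ix; apply/t_closureP => //; exists [:: x].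
  by move=> y /=; rewrite inE => /eqP ->.
by apply: sub_v_closure; rewrite /= mem_head.
Qed.

Lemma t_idealP I : ideal I -> nonzero I ->
  t_ideal I <-> forall s, [set` s] `<=` I -> v_closure [set` s] `<=` I.
Proof.
move=> [sI IR] nI; split=> [[_ _ tI] s sJ x sx|H].
  by rewrite -tI; apply/t_closureP => //; exists s.
split=> //; apply/seteqP; split; last exact: sub_t_closure.
by move=> x /t_closureP[]// s /H; exact.
Qed.

Lemma t_ideal_v_closure M X : t_ideal M -> finitely_generated X -> X `<=` M ->
  v_closure X `<=` M.
Proof.
move=> tM /finitely_generatedP[s ->] sM; rewrite /v_closure inverse_spanned.
case: (tM) => iM nM _; apply: (t_idealP iM nM).1 => //.
by move=> y ys; apply: sM; exact: sub_spanned.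
Qed.

Lemma seq_in_t_closure I s : submodule I -> nonzero I ->
  [set` s] `<=` t_closure I ->
  exists2 t : seq K, [set` t] `<=` I & [set` s] `<=` v_closure [set` t].
Proof.
move=> sI nI; elim: s => [|x s IHs] xsI; first by exists [::].
have /IHs[t tI st] : [set` s] `<=` t_closure I.
  by move=> y ys; apply: xsI; rewrite /= inE ys orbT.
have /t_closureP[]// : t_closure I x by apply: xsI; rewrite /= mem_head.
move=> t' t'I xt'; exists (t' ++ t).
  by move=> y /=; rewrite mem_cat => /orP[/t'I|/tI].
move=> y /=; rewrite inE => /predU1P[->|/st].
  by apply: v_closure_mono xt' => z; rewrite /= mem_cat => ->.
by apply: v_closure_mono => z; rewrite /= mem_cat => ->; rewrite orbT.
Qed.

(** The family of finite subsets of I is directed, so finitely many elements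
of I^t lie in F^v for a single finite subset F of I; this
gives both additivity and idempotence. *)
Lemma t_ideal_t_closure I : ideal I -> nonzero I -> t_ideal (t_closure I).
Proof.
move=> [sI IR] nI; have tP x := t_closureP x sI nI.
have iT : ideal (t_closure I).
  split; first split.
  - by apply: sub_t_closure => //; case: sI.
  - move=> a x y Ix Iy.
    have [t tI xyt] : exists2 t : seq K, [set` t] `<=` I
        & [set` [:: x; y]] `<=` v_closure [set` t].
      apply: seq_in_t_closure => // z /=.
      by rewrite !inE => /orP[/eqP->|/eqP->].
    apply/tP; exists t => //.
    by apply: (submodule_inverse (inverse [set` t])).2; apply: xyt;
       rewrite /= !inE eqxx ?orbT.
  - move=> x /tP[t tI] /(_ 1); rewrite mulr1; apply=> y /tI /IR.
    by rewrite mul1r.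
have nT : nonzero (t_closure I).
  by case: nI => z Iz z0; exists z => //; apply: sub_t_closure => //; exists z.
apply/t_idealP => // s /(seq_in_t_closure sI nI)[t tI st] x sx.
by apply/tP; exists t => //; exact: v_closure_min st _ sx.
Qed.

Lemma t_closure_min I M : t_ideal M -> I `<=` M -> t_closure I `<=` M.
Proof.
move=> tM IM x [J [fgJ _ JI]]; apply: t_ideal_v_closure => //.
by move=> y /JI; exact: IM.
Qed.

Lemma t_ideal_properP I : t_ideal I -> I <> base_ring R <-> ~ I 1.
Proof.
move=> [iI _ _]; split=> [+ I1|I1 E]; first by apply; exact: ideal_base_ring.
by apply: I1; rewrite E; exact: base_ring1.
Qed.

(** Zorn's lemma: the t-closure has finite character, so the union of a chain
of proper t-ideals is again one. *)
Lemma maximal_t_ideal_exists I : t_ideal I -> ~ I 1 ->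
  exists2 M, maximal_t_ideal M & I `<=` M.
Proof.
move=> tI I1; pose P A := t_ideal (A `|` I) /\ ~ (A `|` I) 1.
(* Taking A `|` I rather than A lets the empty chain have the upper bound I. *)
have [F FP Ftot|A [[tA A1] maxA]] := @Zorn_bigcup K P.
  have [F0|/set0P[A0 FA0]] := eqVneq F set0.
    by rewrite F0 bigcup_set0 /P set0U.
  have dirF x y : (\bigcup_(X in F) X `|` I) x -> (\bigcup_(X in F) X `|` I) y ->
      exists2 A, F A & (A `|` I) x /\ (A `|` I) y.
    have one z : (\bigcup_(X in F) X `|` I) z -> exists2 A, F A & (A `|` I) z.
      by case=> [[A FA Az]|Iz]; [exists A => //; left|exists A0 => //; right].
    move=> /one[A FA Ax] /one[B FB By].
    have [AB|BA] := Ftot _ _ FA FB; [exists B|exists A] => //; split=> //.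
      by case: Ax => [/AB|]; [left|right].
    by case: By => [/BA|]; [left|right].
  have memF A x : F A -> (A `|` I) x -> (\bigcup_(X in F) X `|` I) x.
    by move=> FA [Ax|Ix]; [left; exists A|right].
  have iU : ideal (\bigcup_(X in F) X `|` I).
    split; first split.
    - by right; case: tI => -[[]].
    - move=> a x y Ux Uy; have [A FA [Ax Ay]] := dirF _ _ Ux Uy.
      by apply: (memF A) => //; case: (FP A FA) => -[[[_ H] _] _ _] _; exact: H.
    - move=> x Ux; have [A FA [Ax _]] := dirF _ _ Ux Ux.
      by case: (FP A FA) => -[[_ H] _ _] _; exact: H.
  have nU : nonzero (\bigcup_(X in F) X `|` I).
    by case: tI => _ [z Iz z0] _; exists z => //; right.
  split; last first.
    move=> U1; have [A FA [A1 _]] := dirF _ _ U1 U1.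
    by case: (FP A FA).
  apply/t_idealP => // s sU x sx.
  have [A FA sA] : exists2 A, F A & [set` s] `<=` A `|` I.
    elim: s sU {sx} => [|y s IHs] sU; first by exists A0.
    have [|B FB sB] := IHs.
      by move=> z zs; apply: sU; rewrite /= inE zs orbT.
    have Uy : (\bigcup_(X in F) X `|` I) y by apply: sU; rewrite /= mem_head.
    have [A FA [Ay _]] := dirF y y Uy Uy.
    have [AB|BA] := Ftot _ _ FA FB.
      exists B => // z; rewrite /= inE => /predU1P[->|/sB//].
      by case: Ay => [/AB|]; [left|right].
    exists A => // z; rewrite /= inE => /predU1P[->//|/sB].
    by case=> [/BA|]; [left|right].
  apply: (memF A) => //; case: (FP A FA) => tA _; case: (tA) => iA nA _.
  exact: (t_idealP iA nA).1 tA _ sA _ sx.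
exists (A `|` I); last by right.
split=> //; first exact/(t_ideal_properP tA).
move=> B tB /(t_ideal_properP tB) B1 AB; apply/seteqP; split=> // x Bx.
apply: contrapT => nAx; apply: (maxA B).
  by split=> [z Az|E]; [apply: AB; left|apply: nAx; left; exact: E].
have BI : B `|` I = B by apply: setUidl => z Iz; apply: AB; right.
by rewrite /P BI.
Qed.

(** If I^t were proper, it would lie in a maximal t-ideal. *)
Lemma t_closure_full I : ideal I -> nonzero I ->
  (forall M, maximal_t_ideal M -> ~ I `<=` M) -> t_closure I = base_ring R.
Proof.
move=> iI nI H; have tI := t_ideal_t_closure iI nI.
apply: contrapT => /(t_ideal_properP tI) /(maximal_t_ideal_exists tI)[M mM IM].
by apply: (H M mM) => x Ix; apply: IM; apply: sub_t_closure => //; case: iI.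
Qed.

(** This pointwise form makes no reference to sums of products; it holds since
I I^-1 is the submodule generated by the products x y. *)
Lemma t_invertibleP I : ideal I -> nonzero I ->
  t_invertible I <-> forall M, maximal_t_ideal M ->
    exists x y, [/\ I x, inverse I y & ~ M (x * y)].
Proof.
move=> iI nI; case: (iI) => sI IR; split=> [[_ _ E] M mM|H].
  apply: contrapT => nex; case: (mM) => tM /(t_ideal_properP tM) M1 _.
  apply: M1; have : t_closure (product I (inverse I)) `<=` M.
    apply: t_closure_min => //; apply: product_min; first by case: tM => -[].
    by move=> x y Ix Iy; apply: contrapT => nM; apply: nex; exists x, y.
  by rewrite E; apply; exact: base_ring1.
split=> //; apply: t_closure_full.
- split; first exact: submodule_product (submodule_inverse _).
  apply: product_min; first exact: submodule_base_ring.
  by move=> x y Ix Iy; rewrite mulrC; exact: Iy.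
- case: nI => z Iz z0; exists z => //; rewrite -[z]mulr1; apply: mem_product => //.
  by move=> y /IR; rewrite mul1r.
- move=> M /H[x [y [Ix Iy nM]]] PM; apply: nM; apply: PM; exact: mem_product.
Qed.

End TIdeals.

(** * Extension to the polynomial ring and content *)

Section Extensions.

Variable R : idomainType.
Local Notation K := {fraction R}.
Local Notation L := {fraction {poly R}}.
Implicit Types (I M : set K) (J N : set L) (a b : R) (f g p q : {poly R}).

Definition polys I : set L :=
  [set x | exists2 p : {poly R}, forall i, I (p`_i)%:F & p%:F = x].

Definition content J : set K :=
  [set x | exists2 p : {poly R}, J p%:F & exists i, (p`_i)%:F = x].

Lemma mem_polys I p : polys I p%:F <-> forall i, I (p`_i)%:F.
Proof.
split=> [[q Iq /eqP]|Ip]; last by exists p.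
by rewrite tofrac_eq => /eqP <-.
Qed.

Lemma mem_polysC I a : submodule I -> polys I (a%:P)%:F <-> I a%:F.
Proof.
move=> [I0 _]; split=> [/mem_polys/(_ 0%N)|Ia]; first by rewrite coefC.
by apply/mem_polys => -[|i]; rewrite coefC//= tofrac0.
Qed.

Lemma polys_mono I M : I `<=` M -> polys I `<=` polys M.
Proof. by move=> IM _ [p Ip <-]; exists p => // i; apply: IM. Qed.

Lemma submodule_polys I : submodule I -> submodule (polys I).
Proof.
move=> sI; split.
  by exists 0; rewrite ?tofrac0// => i; rewrite coef0 tofrac0; case: sI.
move=> a _ _ [p Ip <-] [q Iq <-]; exists (a * p + q); last first.
  by rewrite tofracD tofracM.
move=> i; rewrite coefD tofracD; apply: submoduleD => //.
rewrite coefM rmorph_sum; apply: submodule_sum => // j _ /=.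
by rewrite tofracM; exact: submoduleZ.
Qed.

Lemma ideal_polys I : ideal I -> ideal (polys I).
Proof.
move=> [sI _]; split; first exact: submodule_polys.
by move=> _ [p _ <-]; exact: base_ringE.
Qed.

Lemma nonzero_polys I : ideal I -> nonzero I -> nonzero (polys I).
Proof.
move=> [sI IR] [z Iz z0]; have [a _ az] := IR z Iz; exists (a%:P)%:F.
  by apply/mem_polysC; rewrite ?az.
by rewrite tofrac_eq0 polyC_eq0 -tofrac_eq0 az.
Qed.

(** Multiplying by powers of X aligns any two coefficients, so the coefficients
themselves form an ideal, and no sums of them need be added. *)
Lemma submodule_content J : submodule J -> submodule (content J).
Proof.
move=> sJ; split.
  exists 0; first by rewrite tofrac0; case: sJ.
  by exists 0%N; rewrite coef0 tofrac0.
move=> a _ _ [p Jp [i <-]] [q Jq [j <-]].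
exists ((a%:P * 'X^j) * p + 'X^i * q).
  rewrite tofracD tofracM; apply: sJ.2 => //; rewrite tofracM.
  exact: submoduleZ.
exists (i + j)%N; rewrite -mulrA coefD coefCM !coefXnM tofracD tofracM.
by rewrite !ltnNge leq_addr leq_addl /= addnK addKn.
Qed.

Lemma ideal_content J : ideal J -> ideal (content J).
Proof.
move=> [sJ _]; split; first exact: submodule_content.
by move=> _ [p _ [i <-]]; exact: base_ringE.
Qed.

Lemma mem_content J p i : J p%:F -> content J (p`_i)%:F.
Proof. by move=> Jp; exists p => //; exists i. Qed.

Lemma nonzero_content J : ideal J -> nonzero J -> nonzero (content J).
Proof.
move=> [_ JR] [z Jz z0]; have [p _ pz] := JR z Jz.
exists (lead_coef p)%:F; first by apply: mem_content; rewrite pz.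
by rewrite tofrac_eq0 lead_coef_eq0 -tofrac_eq0 pz.
Qed.

(** Content and extension form a Galois connection. *)
Lemma sub_polysE J I : ideal J -> J `<=` polys I <-> content J `<=` I.
Proof.
move=> [_ JR]; split=> [JI _ [p /JI /mem_polys Ip [i <-]] //|cJ x Jx].
have [p _ px] := JR x Jx; exists p => // i.
by apply: cJ; apply: mem_content; rewrite px.
Qed.

Lemma base_ring_seq (D : idomainType) (s : seq {fraction D}) :
  [set` s] `<=` base_ring D -> exists t : seq D, s = [seq d%:F | d <- t].
Proof.
elim: s => [|x s IHs] sR; first by exists [::].
have [y ys|t ->] := IHs; first by apply: sR; rewrite /= inE ys orbT.
have [a _ <-] : base_ring D x by apply: sR; rewrite /= mem_head.
by exists (a :: t).
Qed.

(** Generators of the content of the ideal generated by ps. *)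
Definition coefs (ps : seq {poly R}) : seq K :=
  [seq c%:F | c <- flatten [seq polyseq p | p <- ps]].

Lemma sub_coefs I ps : submodule I ->
  [set` coefs ps] `<=` I <-> [set` [seq p%:F | p <- ps]] `<=` polys I.
Proof.
move=> [I0 _]; split=> [cI y /mapP[p pps ->{y}]|pI y /mapP[c /flattenP[q]]].
  apply/mem_polys => i; have [pi|pi] := ltnP i (size p).
    apply: cI; apply: map_f; apply/flattenP; exists (polyseq p).
      exact: map_f.
    exact: mem_nth.
  by rewrite nth_default// tofrac0.
move=> /mapP[p pps ->] /(nthP 0)[i _ <-] ->{y}.
by have /mem_polys : polys I p%:F by apply: pI; exact: map_f.
Qed.

Lemma finitely_generated_polys I : ideal I -> finitely_generated I ->
  finitely_generated (polys I).
Proof.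
move=> [sI IR] /finitely_generatedP[s Is].
have [|t st] := @base_ring_seq R s.
  by move=> y ys; apply: IR; rewrite Is; exact: sub_spanned.
apply/finitely_generatedP; exists [seq (a%:P)%:F | a <- t].
apply/seteqP; split; last first.
  apply: spanned_min; first exact: submodule_polys.
  move=> y /mapP[a at_ ->{y}]; apply/mem_polysC => //; rewrite Is.
  by apply: sub_spanned; rewrite /= st; exact: map_f.
set S := spanned _; have sS : submodule S := submodule_spanned _.
(* Membership of a constant in S is linear in the constant, so the generators
   of I suffice. *)
suff IS : I `<=` [set x | exists2 a : R, S (a%:P)%:F & a%:F = x].
  move=> _ [p Ip <-]; rewrite -[p]coefK poly_def rmorph_sum /=.
  apply: submodule_sum => // i _; rewrite -mul_polyC mulrC tofracM.
  apply: (submoduleZ _ sS); have [a Sa /eqP] := IS _ (Ip i).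
  by rewrite tofrac_eq => /eqP <-.
rewrite Is; apply: spanned_min.
  split; first by exists 0; rewrite ?tofrac0//; case: sS.
  move=> c _ _ [a Sa <-] [b Sb <-]; exists (c * a + b).
    by rewrite polyCD polyCM tofracD tofracM; exact: sS.2.
  by rewrite tofracD tofracM.
move=> x; rewrite /= st => /mapP[a at_ ->]; exists a => //.
by apply: sub_spanned; exact: (map_f (fun a : R => (a%:P)%:F)).
Qed.

Lemma finitely_generated_content J : ideal J -> finitely_generated J ->
  finitely_generated (content J).
Proof.
move=> iJ /finitely_generatedP[s Js]; case: (iJ) => sJ JR.
have [|ps sps] := @base_ring_seq _ s.
  by move=> y ys; apply: JR; rewrite Js; exact: sub_spanned.
apply/finitely_generatedP; exists (coefs ps); apply/seteqP; split.
  apply/sub_polysE => //; rewrite Js.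
  apply: spanned_min; first exact: submodule_polys (submodule_spanned _).
  rewrite sps; apply/sub_coefs; first exact: submodule_spanned.
  exact: sub_spanned.
apply: spanned_min; first exact: submodule_content.
apply/sub_coefs; first exact: submodule_content.
rewrite -sps => x xs; apply: ((sub_polysE _ iJ).2 (fun=> id)).
by rewrite Js; exact: sub_spanned.
Qed.

(** McCoy's theorem for the module Q = R / (I meet R): if no nonzero element of
Q is killed by all coefficients of g, then g kills no nonzero polynomial with
coefficients in Q.
The induction is on the degree of p. Once g`_j *: p is known to vanish modulo I
for all j > i, the coefficient of g * p of degree i + deg p is
g`_i * lead_coef p modulo I; removing the leading term from g`_i *: p then
leaves a polynomial of smaller degree that g still kills. *)
Lemma mccoy I g p : submodule I ->
  (forall a, (forall i, I (g`_i * a)%:F) -> I a%:F) ->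
  polys I (g * p)%:F -> polys I p%:F.
Proof.
move=> sI gI; have sP := submodule_polys sI.
have [n] := ubnP (size p); elim: n p => // n IHn p /ltnSE pn Igp.
suff Ig i : polys I (g`_i *: p)%:F.
  apply/mem_polys => j; apply: gI => i.
  by move/mem_polys: (Ig i) => /(_ j); rewrite coefZ.
have [->|p0] := eqVneq p 0; first by rewrite scaler0 tofrac0; case: sP.
have [k] := ubnP (size g - i)%N; elim: k i => // k IHk i /ltnSE ik.
have Ilead : I (g`_i * lead_coef p)%:F.
  set m := (size p).-1; have := (mem_polys _ _).1 Igp (i + m)%N.
  rewrite coefM (bigD1 (inord i : 'I_(i + m).+1))//= inordK ?ltnS ?leq_addr//.
  rewrite addKn -/(lead_coef p) tofracD => Isum.
  set z : K := _%:F; set S := (X in z + X) in Isum.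
  rewrite -[z](addrK S); apply: submoduleB => //.
  rewrite /S rmorph_sum; apply: submodule_sum => // j.
  rewrite -val_eqE /= inordK ?ltnS ?leq_addr//.
  rewrite neq_ltn => /orP[ji|ij].
    rewrite [p`_(_ - _)]nth_default ?mulr0 ?tofrac0; first by case: sI.
    by rewrite -(prednK (n := size p)) ?size_poly_gt0// -/m ltn_subRL ltn_add2r.
  have [gj|gj] := leqP (size g) j.
    by rewrite nth_default// mul0r tofrac0; case: sI.
  have /mem_polys/(_ (i + m - j)%N) : polys I (g`_j *: p)%:F.
    by apply: IHk; apply: leq_trans ik; rewrite ltn_sub2l// (ltn_trans ij).
  by rewrite coefZ.
pose r := (g`_i * lead_coef p) *: 'X^((size p).-1).
have Ir : polys I r%:F.
  rewrite /r -mul_polyC mulrC tofracM; apply: submoduleZ => //.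
  exact/mem_polysC.
rewrite -[_ *: p](subrK r) tofracD; apply: submoduleD => //; apply: IHn.
  apply: leq_trans pn; rewrite -(prednK (n := size p)) ?size_poly_gt0// ltnS.
  apply/leq_sizeP => j; rewrite leq_eqVlt => /predU1P[<-|mj].
    by rewrite coefB !coefZ coefXn eqxx mulr1 subrr.
  rewrite coefB !coefZ coefXn gtn_eqF// mulr0 subr0 [p`_j]nth_default ?mulr0//.
  by rewrite -(prednK (n := size p)) ?size_poly_gt0.
rewrite mulrBr tofracB -scalerAr -mul_polyC; apply: submoduleB => //.
  by rewrite tofracM; exact: submoduleZ.
by rewrite tofracM; exact: submoduleZ.
Qed.

Lemma base_ring_polyP p b : b != 0 ->
  base_ring {poly R} (p%:F / (b%:P)%:F) <->
  forall i, base_ring R ((p`_i)%:F / b%:F).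
Proof.
move=> b0; have bF0 : b%:F != 0 :> K by rewrite tofrac_eq0.
have bP0 : (b%:P)%:F != 0 :> L by rewrite tofrac_eq0 polyC_eq0.
split=> [[q _ qE] i|bp].
  have /eqP : p%:F = (q * b%:P)%:F by rewrite tofracM qE divfK.
  rewrite tofrac_eq => /eqP ->.
  by rewrite coefMC tofracM mulfK//; exact: base_ringE.
have /choice[c cE] i : exists c : R, c * b = p`_i.
  have [c _ cE] := bp i; exists c; apply/eqP.
  by rewrite -tofrac_eq tofracM cE divfK.
exists (\poly_(i < size p) c i) => //; apply: (canRL (mulfK bP0)).
rewrite -tofracM; congr _%:F; apply/polyP => i; rewrite coefMC coef_poly.
by case: ltnP => [_|pi]; rewrite ?cE// mul0r nth_default.
Qed.

End Extensions.

(** * Maximal t-ideals of the polynomial ring *)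

Section MaximalTIdeals.

Variable R : idomainType.
Local Notation K := {fraction R}.
Local Notation L := {fraction {poly R}}.
Implicit Types (I M : set K) (J N : set L) (a b : R) (f g p q : {poly R}).

(** Equivalently c(g)^-1 = R, or c(g)^v = R. *)
Definition superprimitive g :=
  forall u : K, (forall i, base_ring R (u * (g`_i)%:F)) -> base_ring R u.

(** A polynomial over the quotient field of R whose product with a
superprimitive polynomial has coefficients in R has coefficients in R itself.
Polynomials over the quotient field are represented inside the fractions of
R[X] as those x that a nonzero constant b multiplies into R[X]; the claim is
then McCoy's theorem for the module R / bR. *)
Lemma superprimitive_cancel g (x : L) b p :
  superprimitive g -> b != 0 -> x * (b%:P)%:F = p%:F ->
  base_ring {poly R} (x * g%:F) -> base_ring {poly R} x.
Proof.
move=> gS b0 xb [q _ qE].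
have bP0 : (b%:P)%:F != 0 :> L by rewrite tofrac_eq0 polyC_eq0.
have -> : x = p%:F / (b%:P)%:F by rewrite -xb mulfK.
pose I : set K := [set y | base_ring R (y / b%:F)].
have sI : submodule I.
  split=> [|c y z Iy Iz]; rewrite /I /=.
    by rewrite mul0r; case: (submodule_base_ring R).
  by rewrite mulrDl -mulrA; exact: (submodule_base_ring R).2.
apply/(base_ring_polyP _ b0); apply/(mem_polys I); apply: (mccoy (g := g)) => //.
  move=> a Ia; apply: gS => i; rewrite mulrC mulrA -tofracM; exact: Ia.
apply/mem_polys; apply/(base_ring_polyP _ b0).
exists q => //; rewrite qE tofracM -xb mulrCA -!mulrA divff// mulr1.
by rewrite mulrC.
Qed.

(** A finite set s of polynomials satisfies s^v <= c(s)^v[X]: an element a / b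
of c(s)^-1, viewed as a fraction of R[X], is in s^-1. *)
Lemma t_ideal_polys I : t_ideal I -> t_ideal (polys I).
Proof.
move=> tI; case: (tI) => iI nI _; case: (iI) => sI IR.
have iP := ideal_polys iI; have nP := nonzero_polys iI nI.
apply/t_idealP => // s sP.
have [|ps E] := @base_ring_seq _ s; first by move=> y /sP; apply: iP.2.
rewrite E in sP *; move=> x vx.
have [p _ px] : base_ring {poly R} x.
  by rewrite -[x]mulr1; apply: vx => y /sP /iP.2; rewrite mul1r.
rewrite -{x}px in vx *; apply/mem_polys => i.
move/(t_idealP iI nI): (tI) => /(_ (coefs ps)); apply.
  exact/sub_coefs.
move=> u uc; have [a [b [b0 ue]]] := fraction_repr u.
have := vx ((a%:P)%:F / (b%:P)%:F); rewrite mulrA -tofracM.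
case/(_ _)/(base_ring_polyP _ b0)/(_ i) => [y|c _ cE].
  case/mapP=> q qps ->{y}; rewrite mulrAC -tofracM.
  apply/(base_ring_polyP _ b0) => j; rewrite coefCM tofracM mulrAC -ue.
  have [qj|qj] := ltnP j (size q); last first.
    rewrite nth_default// tofrac0 mulr0; exact: (submodule_base_ring R).1.
  apply: uc; apply: map_f; apply/flattenP; exists (polyseq q).
    exact: map_f.
  exact: mem_nth.
by exists c => //; rewrite cE coefMC ue mulrA tofracM.
Qed.

Lemma polysP1 I : submodule I -> polys I 1 <-> I 1.
Proof.
by move=> sI; rewrite -(tofrac1 R) -(tofrac1 {poly R}) -polyC1; exact: mem_polysC.
Qed.

(** Shifting by the size of g makes the coefficients of the new polynomial
follow those of g without overlap. *)
Lemma coefs_in_content J (s : seq K) : submodule J -> [set` s] `<=` content J ->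
  exists2 g, J g%:F & forall y, y \in s -> exists i, y = (g`_i)%:F.
Proof.
move=> sJ; elim: s => [|y s IHs] sub; first by exists 0; rewrite ?tofrac0; case: sJ.
have [z zs|g Jg sg] := IHs; first by apply: sub; rewrite /= inE zs orbT.
have [f Jf [i fi]] : content J y by apply: sub; rewrite /= mem_head.
pose h := g + 'X^(size g) * f; exists h.
  by rewrite tofracD tofracM; apply: submoduleD => //; exact: submoduleZ.
move=> z; rewrite inE => /predU1P[->|/sg[j ->]].
  exists (size g + i)%N; rewrite coefD coefXnM ltnNge leq_addr addKn.
  by rewrite nth_default ?leq_addr// add0r.
have [jg|jg] := ltnP j (size g).
  by exists j; rewrite coefD coefXnM jg addr0.
(* Here the coefficient is 0, and so is every coefficient beyond the size. *)
by exists (size h); rewrite !nth_default.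
Qed.

Lemma superprimitive_exists J : ideal J -> nonzero J ->
  t_closure (content J) 1 -> exists2 g, J g%:F & superprimitive g.
Proof.
move=> iJ nJ /t_closureP[].
- by case: (ideal_content iJ).
- exact: nonzero_content.
move=> s /coefs_in_content[|g Jg sg v1]; first by case: iJ.
exists g => // u ug; rewrite -[u]mul1r; apply: v1 => y /sg[i ->]; exact: ug.
Qed.

(** The v-closure of (a, g) is R[X]: if u a and u g are in R[X], then u is a
polynomial over the quotient field of R, and g can be cancelled. *)
Lemma superprimitive_constant_full N g a : t_ideal N -> N g%:F -> superprimitive g ->
  a != 0 -> N (a%:P)%:F -> N 1.
Proof.
move=> tN Ng gS a0 Na; case: (tN) => iN nN _.
have /(_ [:: g%:F; (a%:P)%:F])  := (t_idealP iN nN).1 tN; apply.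
  by move=> y /=; rewrite !inE => /orP[/eqP->|/eqP->].
move=> u uga; rewrite mul1r.
have [p _ pE] : base_ring {poly R} (u * (a%:P)%:F).
  by apply: uga; rewrite /= !inE eqxx orbT.
apply: (superprimitive_cancel gS a0 (esym pE)).
by apply: uga; rewrite /= mem_head.
Qed.

Lemma polys_reflects_sub I M : ideal I -> submodule M ->
  polys I `<=` polys M -> I `<=` M.
Proof.
move=> [sI IR] sM IM x Ix; have [a _ ax] := IR x Ix.
rewrite -ax in Ix *; apply/(mem_polysC _ sM); apply: IM; exact/mem_polysC.
Qed.

(** With M the t-closure of c(N), the proper t-ideal M[X] contains N, so it
equals N. *)
Lemma maximal_t_ideal_content N : maximal_t_ideal N ->
  ~ t_closure (content N) 1 ->
  exists2 M, maximal_t_ideal M & N = polys M.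
Proof.
move=> [tN N1 maxN] nc; set M := t_closure _ in nc.
case: (tN) => iN nN _; have iC := ideal_content iN.
have tM : t_ideal M := t_ideal_t_closure iC (nonzero_content iN nN).
have NM : N `<=` polys M.
  apply/sub_polysE => //; apply: sub_t_closure; first by case: iC.
  exact: nonzero_content.
have iM I : t_ideal I -> submodule I by case=> -[].
have polysN I : t_ideal I -> I <> base_ring R -> N `<=` polys I -> polys I = N.
  move=> tI /(t_ideal_properP tI) I1 NI; apply: maxN => //.
    exact: t_ideal_polys.
  apply/(t_ideal_properP (t_ideal_polys tI)) => /polysP1 H.
  by apply: I1; apply: H; exact: iM.
have E : polys M = N by apply: polysN => //; exact/(t_ideal_properP tM).
exists M => //; split=> //; first exact/(t_ideal_properP tM).
move=> I tI I1 MI; apply/seteqP; split=> //.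
apply: polys_reflects_sub; [by case: tI|exact: iM|].
by rewrite E polysN// -E; exact: polys_mono.
Qed.

Lemma maximal_t_ideal_constant N a : maximal_t_ideal N ->
  a != 0 -> N (a%:P)%:F -> exists2 M, maximal_t_ideal M & N = polys M.
Proof.
move=> mN a0 Na; apply: maximal_t_ideal_content => // c1.
case: (mN) => tN /(t_ideal_properP tN) N1 _; case: (tN) => iN nN _.
have [g Ng gS] := superprimitive_exists iN nN c1.
by apply: N1; exact: superprimitive_constant_full gS a0 Na.
Qed.

Lemma ideal_constant I : ideal I -> nonzero I -> exists2 a, a != 0 & I a%:F.
Proof.
move=> [_ IR] [z Iz z0]; have [a _ az] := IR z Iz.
by exists a; rewrite ?az// -tofrac_eq0 az.
Qed.

Lemma maximal_t_ideal_over I N : ideal I -> nonzero I -> maximal_t_ideal N ->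
  polys I `<=` N -> exists M, [/\ maximal_t_ideal M, N = polys M & I `<=` M].
Proof.
move=> iI nI mN IN; have [a a0 Ia] := ideal_constant iI nI.
have [|M mM NM] := maximal_t_ideal_constant mN a0.
  by apply: IN; apply/mem_polysC => //; case: iI.
exists M; split=> //; apply: polys_reflects_sub => //.
  by case: mM => -[[]].
by rewrite -NM.
Qed.

Lemma maximal_t_ideal_polys M : maximal_t_ideal M -> maximal_t_ideal (polys M).
Proof.
move=> mM; case: (mM) => tM /(t_ideal_properP tM) M1 maxM.
case: (tM) => iM nM _.
have [|N mN MN] := maximal_t_ideal_exists (t_ideal_polys tM).
  by move/polysP1 => H; apply: M1; apply: H; case: iM.
have [I [mI NI MI]] := maximal_t_ideal_over iM nM mN MN.
by case: (mI) => tI I1 _; rewrite -(maxM I)// -NI.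
Qed.

End MaximalTIdeals.

(** * Rigid ideals *)

Section Rigidity.

Variable R : idomainType.
Implicit Types (I J M : set {fraction R}).

Lemma t_invertible_over I : ideal I -> nonzero I ->
  (forall M, maximal_t_ideal M -> I `<=` M ->
     exists x y, [/\ I x, inverse I y & ~ M (x * y)]) -> t_invertible I.
Proof.
move=> iI nI H; apply/t_invertibleP => // M mM.
have [IM|/existsNP[x /not_implyP[Ix Mx]]] := pselect (I `<=` M).
  exact: H.
exists x, 1; split; rewrite ?mulr1// => y /iI.2.
by rewrite mul1r.
Qed.

(** The hypotheses say that M = I^v. A maximal t-ideal containing I contains
I^v, so M is the only one. A larger ideal J inside M satisfies
I <= J <= I^v, so it has the same inverse as I, and the witness against
I I^-1 <= M serves for J too. *)
Lemma v_finite_t_super_rigid I M : maximal_t_ideal M ->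
  ideal I -> nonzero I -> finitely_generated I ->
  I `<=` M -> M `<=` v_closure I ->
  (exists x y, [/\ I x, inverse I y & ~ M (x * y)]) -> t_super_rigid I.
Proof.
move=> mM iI nI fI IM MI [x [y [Ix Iy nxy]]].
have only M' : maximal_t_ideal M' -> I `<=` M' -> M' = M.
  move=> [tM' M'1 _] IM'; case: (mM) => _ _; apply=> // z /MI.
  exact: t_ideal_v_closure.
split; first split=> //.
  by exists M; split=> // M' [mM' IM']; rewrite (only M').
move=> J iJ _ IJ; apply: t_invertible_over => //.
  by case: nI => z Iz z0; exists z => //; exact: IJ.
move=> M' mM' JM'.
have EM : M' = M by apply: only => // z /IJ; exact: JM'.
rewrite EM in JM' *; exists x, y; split=> //; first exact: IJ.
have : inverse I `<=` inverse J.
  by rewrite -(inverse_v_closure I); apply: inverse_anti => z /JM' /MI.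
by apply.
Qed.

End Rigidity.

Section PolynomialRing.

Variable R : idomainType.
Local Notation K := {fraction R}.
Local Notation L := {fraction {poly R}}.
Implicit Types (I M : set K) (J N : set L) (a b : R) (f g p q : {poly R}).

(** A polynomial f of least degree in N generates N up to constants: the
remainder of a pseudo-division by f is in N, so it is 0. *)
Lemma pseudo_generator N : ideal N -> nonzero N -> exists f, [/\ f != 0, N f%:F &
  forall p, N p%:F -> exists a q, a != 0 /\ a *: p = q * f].
Proof.
move=> [sN NR] [z Nz z0]; have [p0 _ pz] := NR z Nz.
pose P n := `[< exists p, [/\ p != 0, N p%:F & size p = n] >].
have exP : exists n, P n.
  exists (size p0); apply/asboolP; exists p0; split=> //; last by rewrite pz.
  by rewrite -tofrac_eq0 pz.
have [_ /asboolP[f [f0 Nf <-]] fmin] := ex_minnP exP.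
exists f; split=> // p Np.
have pE := Pdiv.Idomain.divp_eq p f.
set a := lead_coef f ^+ _ in pE; exists a, (p %/ f); split.
  by rewrite expf_neq0// lead_coef_eq0.
have [r0|r0] := eqVneq (p %% f) 0; first by rewrite pE r0 addr0.
have Nr : N (p %% f)%:F.
  have -> : p %% f = a%:P * p - (p %/ f) * f by rewrite mul_polyC pE addrC addKr.
  by rewrite tofracB !tofracM; apply: submoduleB => //; exact: submoduleZ.
have := fmin (size (p %% f)); rewrite leqNgt Pdiv.CommonIdomain.ltn_modp f0.
by move=> H; exfalso; suff: false by []; apply: H; apply/asboolP; exists (p %% f).
Qed.

(** The ideal J = (f, g) works, with f of least degree in N and g
superprimitive. To see that N <= J^v, take p in N, a * p = q * f with a a
nonzero constant, and u in J^-1. Then a * (u * p) = q * (u * f) is in R[X] and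
g * (u * p) is in R[X], so u * p is in R[X]. *)
Lemma upper_t_super_rigid N : maximal_t_ideal N ->
  (forall a, N (a%:P)%:F -> a = 0) -> exists2 J, t_super_rigid J & J `<=` N.
Proof.
move=> mN N0; case: (mN) => -[iN nN _] _ _; case: (iN) => sN NR.
have [g Ng gS] : exists2 g, N g%:F & superprimitive g.
  apply: superprimitive_exists => //; apply: contrapT => c1.
  have [M mM NM] := maximal_t_ideal_content mN c1.
  case: (mM) => -[iM nM _] _ _; have [a a0 Ma] := ideal_constant iM nM.
  move/eqP: a0; apply; apply: N0; rewrite NM; apply/mem_polysC => //.
  by case: iM.
have [f [f0 Nf fdiv]] := pseudo_generator iN nN.
have f0F : f%:F != 0 :> L by rewrite tofrac_eq0.
pose s := [:: f%:F; g%:F : L]; have sNs : spanned s `<=` N.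
  by apply: spanned_min => // z /=; rewrite !inE => /orP[/eqP->|/eqP->].
have sf : spanned s f%:F by apply: sub_spanned; rewrite /= mem_head.
exists (spanned s) => //; apply: (v_finite_t_super_rigid mN) => //.
- by split; [exact: submodule_spanned|move=> z /sNs /NR].
- by exists f%:F.
- by apply/finitely_generatedP; exists s.
- move=> h Nh u; rewrite inverse_spanned => us.
  have [p _ ph] := NR h Nh; rewrite -{h}ph in Nh *.
  have [a [q [a0 apq]]] := fdiv p Nh.
  have [r _ rE] : base_ring {poly R} (u * f%:F) by apply: us; rewrite /= mem_head.
  apply: (superprimitive_cancel (p := q * r) gS a0).
    by rewrite mulrAC -tofracM mulrC [p * _]mulrC mul_polyC apq !tofracM rE mulrCA.
  rewrite -mulrA; apply: base_ringM; first exact: base_ringE.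
  by apply: us; rewrite /= !inE eqxx orbT.
(* From a * g = q * f, the fraction a / f sends f to a and g to q. *)
- have [a [q [a0 agq]]] := fdiv g Ng.
  exists f%:F, ((a%:P)%:F / f%:F); split=> //; last first.
    by rewrite mulrC divfK// => /N0 /eqP; rewrite (negPf a0).
  rewrite inverse_spanned => z /=; rewrite !inE => /orP[/eqP->|/eqP->].
    by rewrite divfK//; exact: base_ringE.
  rewrite mulrAC -tofracM mul_polyC agq tofracM mulfK//; exact: base_ringE.
Qed.

Lemma t_rigid_polys I : t_rigid I -> t_rigid (polys I).
Proof.
move=> [iI nI fI [M [[mM IM] uM]]]; split.
- exact: ideal_polys.
- exact: nonzero_polys.
- exact: finitely_generated_polys.
exists (polys M); split.
  by split; [exact: maximal_t_ideal_polys|exact: polys_mono].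
move=> N [mN /maximal_t_ideal_over[]// M' [mM' -> IM']].
by rewrite (uM M').
Qed.

(** An element u of c(J)^-1 multiplies every polynomial of J into R[X]. If u
times some coefficient of p in J avoids M, then u * p avoids M[X]. *)
Lemma t_super_rigid_polys I : t_super_rigid I -> t_super_rigid (polys I).
Proof.
move=> [rI sI]; split; first exact: t_rigid_polys.
case: rI => iI nI _ _ J iJ fJ IJ.
have nJ : nonzero J.
  by have [z Iz z0] := nonzero_polys iI nI; exists z => //; exact: IJ.
apply: t_invertible_over => // N mN JN.
have [|M [mM NM IM]] := maximal_t_ideal_over iI nI mN.
  by move=> z /IJ /JN.
have iC := ideal_content iJ; have nC := nonzero_content iJ nJ.
have tC : t_invertible (content J).
  apply: sI => //; first exact: finitely_generated_content.
  apply: polys_reflects_sub => //; first by case: iC.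
  by move=> z /IJ; move: z; apply/sub_polysE.
have [_ [u [[p Jp [i <-]] uC npu]]] := (t_invertibleP iC nC).1 tC M mM.
have [a [b [b0 ue]]] := fraction_repr u.
exists p%:F, ((a%:P)%:F / (b%:P)%:F); split=> //.
  move=> y Jy; have [q _ qy] := iJ.2 y Jy; rewrite -{y}qy in Jy *.
  rewrite mulrAC -tofracM; apply/(base_ring_polyP _ b0) => j.
  by rewrite coefCM tofracM mulrAC -ue; apply: uC; exact: mem_content.
rewrite NM => Mpu; apply: npu.
have [r _ rE] : base_ring {poly R} (p%:F * ((a%:P)%:F / (b%:P)%:F)).
  by case: Mpu => r _ <-; exact: base_ringE.
rewrite -rE in Mpu; move/mem_polys: Mpu => /(_ i).
have bP0 : (b%:P)%:F != 0 :> L by rewrite tofrac_eq0 polyC_eq0.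
have bF0 : b%:F != 0 :> K by rewrite tofrac_eq0.
have /eqP : (r * b%:P)%:F = (p * a%:P)%:F by rewrite !tofracM rE mulrA divfK.
rewrite tofrac_eq => /eqP/(congr1 (fun s : {poly R} => (s`_i)%:F)).
rewrite !coefMC !tofracM ue mulrA => <-.
by rewrite mulfK.
Qed.

Lemma t_rigid_content J M : maximal_t_ideal M -> J `<=` polys M ->
  t_rigid J -> t_rigid (content J).
Proof.
move=> mM JM [iJ nJ fJ [N [_ uN]]]; split.
- exact: ideal_content.
- exact: nonzero_content.
- exact: finitely_generated_content.
exists M; split; first by split=> //; exact/sub_polysE.
move=> M' [mM' /(sub_polysE _ iJ) JM'].
have E : polys M = polys M'.
  rewrite -(uN (polys M)); last by split=> //; exact: maximal_t_ideal_polys.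
  by rewrite -(uN (polys M'))//; split=> //; exact: maximal_t_ideal_polys.
have iM P : maximal_t_ideal P -> ideal P by case=> -[].
have pI P Q : maximal_t_ideal P -> maximal_t_ideal Q -> polys P = polys Q -> P `<=` Q.
  by move=> /iM iP /iM iQ PQ; apply: polys_reflects_sub; rewrite ?PQ//; case: iQ.
by apply/seteqP; split; apply: pI.
Qed.

(** Some x in I[X]^-1 and p in I[X] have p * x outside M[X], hence p`_i * x is
outside M[X] for some i. With r = p`_i * x and r`_j outside M, the fraction
r`_j / p`_i is in I^-1: for b in I, comparing coefficients in
r * b = (b * x) * p`_i shows that p`_i divides r`_j * b. *)
Lemma t_invertible_of_polys I : ideal I -> nonzero I ->
  t_invertible (polys I) -> t_invertible I.
Proof.
move=> iI nI tP; apply/t_invertibleP => // M mM.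
have iP := ideal_polys iI; have nP := nonzero_polys iI nI.
have [_ [x [[p Ip <-] xP npx]]] :=
  (t_invertibleP iP nP).1 tP _ (maximal_t_ideal_polys mM).
have sPM : submodule (polys M) by case: mM => -[[/submodule_polys]].
have [i npi] : exists i, ~ polys M (((p`_i)%:P)%:F * x).
  apply: contrapT => /forallNP Mpx; apply: npx.
  rewrite -[p]coefK poly_def rmorph_sum mulr_suml.
  apply: submodule_sum => // i _; rewrite -mul_polyC /= tofracM mulrAC mulrC.
  by apply: (submoduleZ _ sPM); apply: contrapT; exact: Mpx.
have Pi c : I c%:F -> polys I (c%:P)%:F by move=> Ic; apply/mem_polysC => //; case: iI.
have [r _ rE] := xP _ (Pi _ (Ip i)).
have pi0 : p`_i != 0.
  apply/eqP => pi0; apply: npi; rewrite pi0 polyC0 tofrac0 mul0r.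
  by case: sPM.
rewrite mulrC -rE in npi.
have [j nrj] : exists j, ~ M (r`_j)%:F.
  apply: contrapT => /forallNP H; apply: npi; apply/mem_polys => j.
  by apply: contrapT; exact: H.
have pF0 : (p`_i)%:F != 0 :> K by rewrite tofrac_eq0.
exists (p`_i)%:F, ((r`_j)%:F / (p`_i)%:F); split=> //; last first.
  by rewrite mulrC divfK.
move=> y Iy; have [b _ yb] := iI.2 y Iy; rewrite -{y}yb in Iy *.
have [q _ qE] := xP _ (Pi _ Iy).
suff E : r`_j * b = q`_j * p`_i.
  rewrite mulrAC -tofracM E tofracM mulfK//; exact: base_ringE.
have /eqP : (r * b%:P)%:F = (q * (p`_i)%:P)%:F by rewrite !tofracM rE qE mulrAC.
by rewrite tofrac_eq => /eqP/(congr1 (fun s : {poly R} => s`_j)); rewrite !coefMC.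
Qed.

Lemma t_super_rigid_content J M : maximal_t_ideal M -> J `<=` polys M ->
  t_super_rigid J -> t_super_rigid (content J).
Proof.
move=> mM JM [rJ sJ]; split; first exact: (t_rigid_content mM).
case: rJ => iJ nJ _ _ I iI fI JI.
have nI : nonzero I.
  by have [z Jz z0] := nonzero_content iJ nJ; exists z => //; exact: JI.
apply: t_invertible_of_polys => //; apply: sJ.
- exact: ideal_polys.
- exact: finitely_generated_polys.
- exact/sub_polysE.
Qed.

End PolynomialRing.


(** * Descent and ascent of t-potency *)

Theorem theorem3p2 (R : idomainType) :
  (t_potent R <-> t_potent {poly R}) /\
  (t_super_potent R <-> t_super_potent {poly R}).
Proof.
have cases (N : set {fraction {poly R}}) : maximal_t_ideal N ->
    (exists2 M, maximal_t_ideal M & N = polys M) \/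
    exists2 J, t_super_rigid J & J `<=` N.
  move=> mN; have [N0|/existsNP[a /not_implyP[Na /eqP a0]]] :=
    pselect (forall a : R, N (a%:P)%:F -> a = 0).
    by right; exact: upper_t_super_rigid.
  by left; exact: maximal_t_ideal_constant Na.
have cont (M : set {fraction R}) (J : set {fraction {poly R}}) :
    ideal J -> J `<=` polys M -> content J `<=` M.
  by move=> iJ; apply: (sub_polysE M iJ).1.
split; split=> [potR N mN|potP M mM].
- have [[M mM ->]|[J [rJ _] JN]] := cases N mN; last by exists J.
  have [I rI IM] := potR M mM.
  by exists (polys I); [exact: t_rigid_polys|exact: polys_mono].
- have [J rJ JM] := potP _ (maximal_t_ideal_polys mM).
  exists (content J); first exact: (t_rigid_content mM).
  by apply: cont => //; case: rJ.
- have [[M mM ->]|//] := cases N mN.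
  have [I rI IM] := potR M mM.
  by exists (polys I); [exact: t_super_rigid_polys|exact: polys_mono].
- have [J rJ JM] := potP _ (maximal_t_ideal_polys mM).
  exists (content J); first exact: (t_super_rigid_content mM).
  by apply: cont => //; case: rJ => -[].
Qed.
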